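(* There is a constant $c>0$ such that for infinitely many values of $n$ there exists a tournament on $n$ vertices with minimum semidegree at least $\frac{n}{4} + c\, n^{1/5}$ which does not contain the cube (third power) of a Hamilton cycle.
   Context: A tournament is an orientation of a complete graph; its minimum semidegree is the minimum over all vertices of their in- and out-degrees. The cube of a directed cycle $v_0v_1\ldots v_{l}v_0$ is the directed graph on its vertices with edges $v_iv_{i+1},v_iv_{i+2},v_iv_{i+3}$ for all $i$ (indices mod $l+1$); containing the cube of a Hamilton cycle means containing such a subgraph through all vertices. *)

(* Defs.v *)
From mathcomp Require Import all_boot all_order all_algebra.
From mathcomp Require Import all_classical all_reals all_analysis.

Set Implicit Arguments.
Unset Strict Implicit.
Unset Printing Implicit Defensive.

Definition is_tournament (V : finType) (e : rel V) : Prop :=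
  irreflexive e /\ forall x y : V, x != y -> e x y (+) e y x.

Definition outdegree (V : finType) (e : rel V) (x : V) : nat :=
  #|[set y | e x y]|.

Definition indegree (V : finType) (e : rel V) (x : V) : nat :=
  #|[set y | e y x]|.

(* The index #|V| bounds every degree from above, so it does not affect the
   minimum when V is nonempty. *)
Definition min_semidegree (V : finType) (e : rel V) : nat :=
  \big[minn/#|V|]_(x : V) minn (outdegree e x) (indegree e x).

Definition cube_cycle (n : nat) : rel 'I_n := fun i j =>
  [|| j == (i + 1) %% n :> nat, j == (i + 2) %% n :> nat
    | j == (i + 3) %% n :> nat].

(* The injection h is automatically a bijection: it lists all the vertices
   in the cyclic order of the Hamilton cycle. *)
Definition has_hamilton_cycle_cube (V : finType) (e : rel V) : Prop :=
  exists2 h : 'I_#|V| -> V,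
    injective h & forall i j : 'I_#|V|, cube_cycle i j -> e (h i) (h j).

(* Main.v *)
(** Let [A] and [B] be two copies of a finite abelian group [G] of odd order and
    let [D] be a totally ordered [B_4]-family in [G]; here [G] is [F_p ^ 4] and
    [D] is the moment curve.  An edge goes from [b] to [a] when [a - b] lies in
    [D], and then its label is [a - b]; all other edges between the halves go
    from [A] to [B].  Both halves carry Cayley tournaments, so every semidegree is at
    least [(#|G| - 1) / 2 + #|D|].  They are chosen so that labels increase along
    the paths of labelled edges occurring in the cube of a cycle, and, the signed
    sums of four labels being essentially unique, so that the pattern
    [B B A B A] never occurs in such a cube; nor does [B B A A], which would be
    a 4-cycle of labelled edges.  Since [#|A| = #|B|], a Hamilton cycle whose
    cube is present must then alternate between [A] and [B], and labels would
    increase forever along it. *)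
Require Import Defs.
From mathcomp Require Import all_boot all_order all_algebra.
From mathcomp Require Import all_classical all_reals all_analysis.
From mathcomp Require Import zify ring lra.

Set Implicit Arguments.
Unset Strict Implicit.
Unset Printing Implicit Defensive.

Import Order.TTheory GRing.Theory Num.Theory.

(** * Balanced periodic binary sequences *)

Section PeriodicSequences.

Variable n : nat.
Implicit Type s : nat -> bool.

Lemma periodic_muln (T : Type) (f : nat -> T) :
  (forall k, f (k + n) = f k) -> forall m k, f (k + m * n) = f k.
Proof. by move=> per; elim=> [|m IH] k; rewrite ?addn0 // mulSn addnA IH per. Qed.

Lemma periodic_modn (T : Type) (f : nat -> T) :
  (forall k, f (k + n) = f k) -> forall k, f k = f (k %% n).
Proof.
by move=> per k; rewrite [in LHS](divn_eq k n) addnC (periodic_muln per).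
Qed.

Lemma periodic_sum_shift (f : nat -> nat) j :
  (forall k, f (k + n) = f k) -> \sum_(k < n) f (k + j) = \sum_(k < n) f k.
Proof.
move=> per; elim: j => [|j IH]; first by under eq_bigr do rewrite addn0.
rewrite -{}IH -!(big_mkord xpredT (fun k => f (k + _))).
under eq_bigr do rewrite addnS -addSn.
case: n per => [|m] per; first by rewrite !big_geq.
by rewrite big_nat_recr //= (addnC m.+1) per [RHS]big_nat_recl //= addnC.
Qed.

(* If some [true, true] occurs, then the two excluded patterns force
   every later [false] to be followed by two [true]s, so that by periodicity at
   least two thirds of the values are [true]. *)
Lemma balanced_periodic_alternates s :
    0 < n -> (forall k, s (k + n) = s k) -> (\sum_(k < n) s k).*2 = n ->
    (forall k, ~~ [&& s k, s k.+1, ~~ s k.+2 & ~~ s k.+3]) ->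
    (forall k, ~~ [&& s k, s k.+1, ~~ s k.+2, s k.+3 & ~~ s k.+4]) ->
  forall k, s k.+1 = ~~ s k.
Proof.
move=> n_gt0 per bal noTTFF noTTFTF.
have shift j := @periodic_sum_shift (fun k => s k) j
                             (fun k => congr1 nat_of_bool (per k)).
have noTT i : ~~ (s i && s i.+1).
  apply/negP => TTi.
  (* [J k] says that the sequence reads TT, TFTT or FTT from [k] on. The two excluded patterns carry
     it from [k] to [k.+1]. *)
  pose J k := [|| s k && s k.+1, [&& s k, ~~ s k.+1, s k.+2 & s k.+3]
                | [&& ~~ s k, s k.+1 & s k.+2]].
  have J_ge m : J (i + m).
    elim: m => [|m]; first by rewrite /J addn0 TTi.
    move: (noTTFF (i + m)) (noTTFTF (i + m)); rewrite /J !addnS.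
    by do 5!case: (s _).
  have two_of_three k : 2 <= s k + s (k + 1) + s (k + 2).
    (* Moving [k] by [i] whole periods brings it past [i]. *)
    have: J (i + (k + i * n - i)) by [].
    rewrite subnKC; last by rewrite (leq_trans (leq_pmulr i n_gt0)) ?leq_addl.
    rewrite /J -!addSn !(periodic_muln per) addn1 addn2.
    by do 4!case: (s _).
  have : \sum_(k < n) 2 <= \sum_(k < n) (s k + s (k + 1) + s (k + 2)).
    by apply: leq_sum => k _; apply: two_of_three.
  rewrite !big_split /= !shift sum_nat_const card_ord.
  by move: bal n_gt0; move: (\sum_(k < n) s k) => m; clear; lia.
have le1 k : s k + s (k + 1) <= 1.
  by move: (noTT k); rewrite addn1; do 2!case: (s _).
(* The pair sums are at most 1 and, by balance, have mean 1; hence each equals 1. *)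
have sum0 : \sum_(k < n) (1 - (s k + s (k + 1))) = 0.
  rewrite sumnB; last by move=> k _; apply: le1.
  rewrite big_split /= shift sum_nat_const card_ord.
  by move: bal; move: (\sum_(k < n) s k) => m; clear; lia.
have alt k : k < n -> s k.+1 = ~~ s k.
  move=> lt_kn; move/eqP: sum0; rewrite sum_nat_eq0 => /forallP /(_ (Ordinal lt_kn)).
  by move: (noTT k); rewrite /= addn1; do 2!case: (s _).
move=> k; have := alt (k %% n) (ltn_pmod _ n_gt0).
rewrite -(periodic_modn per) => <-.
by rewrite (periodic_modn per) -addn1 -modnDml addn1 -(periodic_modn per).
Qed.

End PeriodicSequences.

(** * Connection sets of Cayley tournaments *)

Section AntisymmetricExtension.

Variables (G : finZmodType) (P : pred G).

Local Open Scope ring_scope.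

(** Between [g] and [- g], when [P] holds of neither, the arbitrary order [enum_rank] decides. *)
Definition antisym_ext (g : G) : bool :=
  P g || [&& g != 0, ~~ P (- g) & (enum_rank g < enum_rank (- g))%N].

Lemma antisym_extP : (forall g : G, g + g = 0 -> g = 0) ->
    (forall g, P g -> ~~ P (- g)) ->
  forall g, g != 0 -> antisym_ext g (+) antisym_ext (- g).
Proof.
move=> no2 Panti g g0; rewrite /antisym_ext opprK oppr_eq0 g0 /=.
have neq : enum_rank g != enum_rank (- g) :> nat.
  apply: contraNneq g0 => /val_inj /enum_rank_inj eqg.
  by rewrite (no2 g) // {1}eqg addNr.
move: (Panti g); case: (P g) => [/(_ isT)|_] /=.
  by case: (P (- g)).
by case: (P (- g)) => //=; case: ltngtP neq.
Qed.

Lemma antisym_ext0 : (forall g, P g -> ~~ P (- g)) -> ~~ antisym_ext 0.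
Proof.
move=> Panti; rewrite /antisym_ext eqxx orbF.
by apply/negP => P0; move: (Panti _ P0); rewrite oppr0 P0.
Qed.

(** The set and its negative partition the nonzero elements. *)
Lemma card_antisym_ext : (forall g : G, g + g = 0 -> g = 0) ->
    (forall g, P g -> ~~ P (- g)) ->
  #|[set g | antisym_ext g]|.*2.+1 = #|G|.
Proof.
move=> no2 Panti; set S := [set g | _].
have cardN : #|[set g | antisym_ext (- g)]| = #|S|.
  suff -> : [set g | antisym_ext (- g)] = -%R @: S.
    by rewrite card_imset //; apply: oppr_inj.
  apply/setP => g; rewrite inE; apply/idP/imsetP => [Sg|[x]].
    by exists (- g); rewrite ?inE ?opprK.
  by rewrite inE => Sx ->; rewrite opprK.
rewrite -cardsT [RHS](cardsD1 0) inE -addnn -{2}cardN -cardsUI add1n.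
have -> : S :&: [set g | antisym_ext (- g)] = finset.set0.
  apply/setP => g; rewrite !inE; case: (eqVneq g 0) => [->|g0].
    by rewrite (negbTE (antisym_ext0 Panti)).
  by move: (antisym_extP no2 Panti g0); do 2!case: (antisym_ext _).
rewrite cards0 addn0; congr (#|pred_of_set _|.+1).
apply/setP => g; rewrite !inE andbT; case: (eqVneq g 0) => [->|g0].
  by rewrite oppr0 (negbTE (antisym_ext0 Panti)).
by move: (antisym_extP no2 Panti g0); do 2!case: (antisym_ext _).
Qed.

End AntisymmetricExtension.

(** * The moment curve as a [B_4]-family *)

Section MomentCurve.

Local Open Scope ring_scope.

(* Newton's identities: [24 * \prod_i (z - x_i)] in terms of [z] and the power
   sums of the [x_i]. *)
Lemma newton4 (R : comPzRingType) (z x1 x2 x3 x4 : R) :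
  let p k := x1 ^+ k + x2 ^+ k + x3 ^+ k + x4 ^+ k in
  24 * ((z - x1) * (z - x2) * (z - x3) * (z - x4)) =
    24 * z ^+ 4 - 24 * p 1%N * z ^+ 3 + 12 * (p 1%N ^+ 2 - p 2%N) * z ^+ 2
    - 4 * (p 1%N ^+ 3 - 3 * p 1%N * p 2%N + 2 * p 3%N) * z
    + (p 1%N ^+ 4 - 6 * p 1%N ^+ 2 * p 2%N + 3 * p 2%N ^+ 2
       + 8 * p 1%N * p 3%N - 6 * p 4%N).
Proof. by move=> p; rewrite /p; ring. Qed.

Definition moment_curve (F : fieldType) (t : F) : 'rV[F]_4 :=
  \row_i t ^+ i.+1.

(** Membership of [x1] alone is enough: permuting the summands gives the same for [x2], [x3] and
    [x4]. *)
Definition B4_family (I : eqType) (G : zmodType) (D : I -> G) : Prop :=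
  forall x1 x2 x3 x4 y1 y2 y3 y4,
    D x1 + D x2 + D x3 + D x4 = D y1 + D y2 + D y3 + D y4 ->
  x1 \in [:: y1; y2; y3; y4].

(** Equal sums mean equal power sums up to degree 4, so by [newton4] the monic quartics with roots
    [x_i] and [y_i] agree, and [x1] is a root of the second. *)
Lemma moment_curve_B4 (F : fieldType) :
  (24 : F) != 0 -> B4_family (@moment_curve F).
Proof.
move=> n24 x1 x2 x3 x4 y1 y2 y3 y4 eqD.
have eqp k : (0 < k <= 4)%N ->
    y1 ^+ k + y2 ^+ k + y3 ^+ k + y4 ^+ k = x1 ^+ k + x2 ^+ k + x3 ^+ k + x4 ^+ k.
  case: k => //= k lt_k4.
  by move/rowP/(_ (Ordinal lt_k4)): eqD; rewrite !mxE.
have: 24 * ((x1 - y1) * (x1 - y2) * (x1 - y3) * (x1 - y4)) = 0.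
  rewrite newton4 (eqp 1%N) // (eqp 2%N) // (eqp 3%N) // (eqp 4%N) //.
  by rewrite -newton4 subrr !(mulr0, mul0r).
move/eqP; rewrite !mulf_eq0 (negbTE n24) /= !subr_eq0 !inE.
by rewrite -!orbA.
Qed.

End MomentCurve.

(** * Counting in a disjoint sum *)

Section FiniteSums.

Variables T U : finType.

Definition is_inr (v : T + U) : bool := if v is inr _ then true else false.

Lemma card_sum_set (Q : pred (T + U)) :
  #|[set v | Q v]| = #|[set a | Q (inl a)]| + #|[set b | Q (inr b)]|.
Proof. by rewrite -!sum1dep_card big_sumType. Qed.

Lemma card_pred_inj (Q : pred T) (f : T -> T) : injective f ->
  #|[set x | Q (f x)]| = #|[set x | Q x]|.
Proof. by move=> f_inj; rewrite -!sum1dep_card [RHS](reindex_inj f_inj). Qed.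

End FiniteSums.

(** * The tournament built from a [B_4]-family *)

Section Tournament.

Variables (d : nat) (G : finZmodType) (D : 'I_d -> G).
Hypothesis no2 : forall g : G, (g + g = 0 -> g = 0)%R.
Hypothesis DB4 : B4_family D.

Local Open Scope ring_scope.

(** Padding both sides with [D y1] adds no new candidate for [x1]. *)
Lemma B4_family2 x1 x2 y1 y2 :
  D x1 + D x2 = D y1 + D y2 -> x1 \in [:: y1; y2].
Proof.
move=> eqD; have := @DB4 x1 x2 y1 y1 y1 y2 y1 y1.
by rewrite eqD !inE => /(_ erefl); do 2!case: eqP.
Qed.

Lemma B4_family3 x1 x2 x3 y1 y2 y3 :
  D x1 + D x2 + D x3 = D y1 + D y2 + D y3 -> x1 \in [:: y1; y2; y3].
Proof.
move=> eqD; have := @DB4 x1 x2 x3 y1 y1 y2 y3 y1.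
by rewrite eqD !inE => /(_ erefl); do 3!case: eqP.
Qed.

Lemma B4_family_inj : injective D.
Proof.
move=> x y eqD; have := @B4_family2 x x y y.
by rewrite eqD !inE orbb => /(_ erefl) /eqP.
Qed.

(* Up to sign, the differences [D x - D y] and [D x + D y' - D x' - D y] along
   paths of [D]-edges with increasing labels. *)
Definition increasing_diff : pred G := fun g =>
  [exists y : 'I_d, exists x : 'I_d, (y < x)%N && (g + D x == D y)] ||
  [exists y : 'I_d, exists x : 'I_d, exists x' : 'I_d, exists y' : 'I_d,
     [&& (y < x)%N, (x < x')%N, (x' < y')%N & g + (D x' + D y) == D x + D y']].

Lemma increasing_diffP (g : G) : reflect
  ((exists y x : 'I_d, (y < x)%N /\ g + D x = D y) \/
   (exists y x x' y' : 'I_d, [/\ (y < x)%N, (x < x')%N, (x' < y')%N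
      & g + (D x' + D y) = D x + D y']))
  (increasing_diff g).
Proof.
apply: (iffP orP).
  case=> [/existsP[y /existsP[x /andP[? /eqP ?]]]|]; first by left; exists y, x.
  case/existsP=> y /existsP[x /existsP[x' /existsP[y' /and4P[? ? ? /eqP ?]]]].
  by right; exists y, x, x', y'.
case=> [[y [x [lt_yx eqg]]]|[y [x [x' [y' [lt1 lt2 lt3 eqg]]]]]].
  by left; apply/existsP; exists y; apply/existsP; exists x; rewrite lt_yx eqg /=.
right; apply/existsP; exists y; apply/existsP; exists x.
apply/existsP; exists x'; apply/existsP; exists y'.
by rewrite lt1 lt2 lt3 eqg /=.
Qed.

(** Adding the equations for [g] and [- g] equates two sums of at most four labels; the resulting
    coincidences contradict the strict inequalities. *)
Lemma increasing_diff_anti g : increasing_diff g -> ~~ increasing_diff (- g).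
Proof.
have addE (a a' b b' : G) : g + a = b -> - g + a' = b' -> a + a' = b + b'.
  by move=> <- <-; rewrite addrACA subrr add0r.
(* Here both [u] and [v'] would have to equal [x], although [u < v']. *)
have mixed (y x v u u' v' : 'I_d) : (y < x)%N -> (v < u)%N -> (u < u')%N ->
    (u' < v')%N -> D x + (D u' + D v) <> D y + (D u + D v').
  move=> yx vu uu' u'v' /esym eqD.
  have: u \in [:: x; u'; v].
    apply: (@B4_family3 u v' y); rewrite -[RHS]addrA -eqD.
    by rewrite addrC.
  have: v' \in [:: x; u'; v].
    apply: (@B4_family3 v' u y); rewrite -[RHS]addrA -eqD.
    by rewrite addrC (addrC (D v')).
  rewrite !inE -!val_eqE /=; lia.
move=> /increasing_diffP Pg; apply/negP => /increasing_diffP Pg'.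
case: Pg Pg' => [[y [x [yx eqg]]]|[y [x [x' [y' [yx xx' x'y' eqg]]]]]].
  case=> [[v [u [vu eqg']]]|[v [u [u' [v' [vu uu' u'v' eqg']]]]]].
    have eqD := addE _ _ _ _ eqg eqg'.
    have := B4_family2 eqD.
    move: eqD; rewrite addrC => /B4_family2.
    rewrite !inE -!val_eqE /=; lia.
  exact: (mixed _ _ _ _ _ _ yx vu uu' u'v' (addE _ _ _ _ eqg eqg')).
case=> [[v [u [vu eqg']]]|[v [u [u' [v' [vu uu' u'v' eqg']]]]]].
  move: (addE _ _ _ _ eqg eqg'); rewrite addrC [RHS]addrC.
  exact: (mixed _ _ _ _ _ _ vu yx xx' x'y').
have /esym eqD := addE _ _ _ _ eqg eqg'.
(* The two largest labels conflict: [y'] is [u'] or [v], hence below [v'], while [v'] is [x'] or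
   [y], hence below [y']. *)
have: y' \in [:: x'; y; u'; v].
  apply: (@DB4 y' x u v'); rewrite -!addrA (addrA (D x')) -eqD.
  by rewrite !addrA (addrC (D y')).
have: v' \in [:: x'; y; u'; v].
  apply: (@DB4 v' u x y'); rewrite -!addrA (addrA (D x')) -eqD.
  by rewrite addrC (addrC (D u)) !addrA.
rewrite !inE -!val_eqE /=; lia.
Qed.

Let S : pred G := antisym_ext increasing_diff.

Let S0 : ~~ S 0 := antisym_ext0 increasing_diff_anti.

Let SN g : S g -> ~~ increasing_diff (- g).
Proof.
case: (eqVneq g 0) => [->|g0 Sg]; first by rewrite (negbTE S0).
move: (antisym_extP no2 increasing_diff_anti g0); rewrite -/(S g) Sg.
by rewrite /antisym_ext; case: increasing_diff.
Qed.

(** In the wrong order the labels would put [- g] in [increasing_diff]; equal labels would put 0 in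
    [S]. *)
Lemma antisym_ext_label_lt g x y : S g -> g + D y = D x -> (x < y)%N.
Proof.
move=> Sg eqg; case: ltngtP => // [lt_yx|/val_inj eqxy].
  case/negP: (SN Sg); apply/increasing_diffP; left; exists y, x; split=> //.
  by rewrite -eqg addKr.
by move: Sg; rewrite -[g](addrK (D y)) eqg eqxy subrr (negbTE S0).
Qed.

(* The two halves [inl] and [inr] are oriented in opposite ways, so that labels
   increase along any path of edges from [inr] to [inl]. *)
Definition B4_tournament : rel (G + G) := fun u v =>
  match u, v with
  | inl a, inl a' => S (a - a')
  | inr b, inr b' => S (b' - b)
  | inr b, inl a => a - b \in codom D
  | inl a, inr b => a - b \notin codom D
  end.

Local Notation e := B4_tournament.

Lemma B4_tournamentP : is_tournament e.
Proof.
split=> [[a|b]|[a|b] [a'|b']] /=; rewrite ?subrr ?(negbTE S0) //.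
- move=> neq; rewrite -[in X in _ (+) X](opprB a a').
  by apply: (antisym_extP no2 increasing_diff_anti); rewrite subr_eq0.
- by case: (_ \in _).
- by case: (_ \in _).
move=> neq; rewrite -(opprB b' b).
by apply: (antisym_extP no2 increasing_diff_anti); rewrite subr_eq0 eq_sym.
Qed.

(** * Monotonicity of labels and forbidden patterns *)

Lemma edge_label b a : e (inr b) (inl a) -> exists x, a = b + D x.
Proof. by move=> /codomP[x eqx]; exists x; rewrite -eqx addrC subrK. Qed.

Lemma label_lt_l a a' b x x' : e (inl a) (inl a') ->
  a = b + D x -> a' = b + D x' -> (x < x')%N.
Proof.
move=> /antisym_ext_label_lt lt ax ax'; apply: lt.
by rewrite ax ax' opprD addrACA subrr add0r subrK.
Qed.

Lemma label_lt_r a b b' x x' : e (inr b) (inr b') ->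
  a = b + D x -> a = b' + D x' -> (x < x')%N.
Proof.
move=> /antisym_ext_label_lt lt ax ax'; apply: lt.
by rewrite addrAC -ax' ax addrAC subrr add0r.
Qed.

(** The 4-cycle gives [D x13 + D x24 = D x23 + D x14], yet [x13] is smaller than both [x23] and
    [x14]. *)
Lemma no_BBAA b1 b2 a3 a4 :
  [/\ e (inr b1) (inr b2), e (inr b1) (inl a3) & e (inr b1) (inl a4)] ->
  [/\ e (inr b2) (inl a3), e (inr b2) (inl a4) & e (inl a3) (inl a4)] -> False.
Proof.
case=> b12 /edge_label[x13 eq13] /edge_label[x14 eq14].
case=> /edge_label[x23 eq23] /edge_label[x24 eq24] a34.
have := label_lt_l a34 eq13 eq14; have := label_lt_r b12 eq13 eq23.
suff: x13 \in [:: x23; x14] by rewrite !inE -!val_eqE /=; lia.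
apply: (@B4_family2 _ x24); apply: (addrI (b1 + b2)).
by rewrite addrACA -eq13 -eq24 (addrC b1) addrACA -eq23 -eq14.
Qed.

(** Labels increase along the path [b1 a3 b2 a5 b4], so [b1 - b4] is of the second kind in
    [increasing_diff]. This forces [b4] to [b1], against the edge from [b1] to [b4]. *)
Lemma no_BBABA b1 b2 a3 b4 a5 :
  [/\ e (inr b1) (inr b2), e (inr b1) (inl a3) & e (inr b1) (inr b4)] ->
  [/\ e (inr b2) (inl a3), e (inr b2) (inr b4) & e (inr b2) (inl a5)] ->
  e (inl a3) (inl a5) -> e (inr b4) (inl a5) -> False.
Proof.
case=> b12 /edge_label[y eq13] b14 [/edge_label[x eq23] b24 /edge_label[x' eq25]].
move=> a35 /edge_label[y' eq45].
have yx := label_lt_r b12 eq13 eq23; have xx' := label_lt_l a35 eq23 eq25.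
have x'y' := label_lt_r b24 eq25 eq45.
case/negP: (SN b14); apply/increasing_diffP; right; exists y, x, x', y'.
split=> //; rewrite opprB addrAC [D x' + _]addrC addrA -eq13.
rewrite eq23 -[b2 + _ + _]addrAC.
by rewrite -eq25 eq45 addrC addrA addKr addrC.
Qed.

Lemma B4_tournament_no_cube : (0 < #|G|)%N -> ~ has_hamilton_cycle_cube e.
Proof.
move=> G_gt0 [h h_inj h_cube].
have n_gt0 : (0 < #|{: G + G}|)%N by rewrite card_sum addn_gt0 G_gt0.
(* The Hamilton cycle unrolled into a periodic sequence on [nat]. *)
pose w k := h (Ordinal (ltn_pmod k n_gt0)).
have w_edge j k : (0 < j < 4)%N -> e (w k) (w (j + k)%N).
  move=> j4; apply: h_cube; rewrite /cube_cycle /= !modnDml !(addnC k).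
  by case: j j4 => [|[|[|[|j]]]] //; rewrite eqxx ?orbT.
have w_per k : w (k + #|{: G + G}|)%N = w k.
  by congr h; apply: val_inj; rewrite /= modnDr.
pose s k := is_inr (w k).
have alt : forall k, s k.+1 = ~~ s k.
  apply: (@balanced_periodic_alternates #|{: G + G}|) => //.
  - by move=> k; rewrite /s w_per.
  - have -> : (\sum_(k < #|{: G + G}|) s k)%N = #|[set v : G + G | is_inr v]|.
      have [g hg gh] : bijective h by apply: inj_card_bij => //; rewrite card_ord.
      rewrite -sum1dep_card (reindex h) /=; last by exists g => ? _.
      rewrite [RHS]big_mkcond; apply: eq_bigr => k _.
      rewrite /s /w (_ : Ordinal _ = k); first by case: is_inr.
      by apply: val_inj; rewrite /= modn_small.
    rewrite card_sum_set (_ : [set a | _] = finset.set0); last first.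
      by apply/setP=> a; rewrite !inE.
    rewrite (_ : [set b | _] = [set: G]); last by apply/setP=> a; rewrite !inE.
    by rewrite cards0 cardsT card_sum addnn.
  - move=> k; apply/negP; rewrite /s.
    have := w_edge 1%N k isT; have := w_edge 2%N k isT; have := w_edge 3%N k isT.
    have := w_edge 1%N k.+1 isT; have := w_edge 2%N k.+1 isT.
    have := w_edge 1%N k.+2 isT; rewrite !(add1n, add2n, addSn, add0n).
    case: (w k) => // b1; case: (w k.+1) => // b2; case: (w k.+2) => // a3.
    by case: (w k.+3) => // a4 * _; apply: (@no_BBAA b1 b2 a3 a4); split.
  move=> k; apply/negP; rewrite /s.
  have := w_edge 1%N k isT; have := w_edge 2%N k isT; have := w_edge 3%N k isT.
  have := w_edge 1%N k.+1 isT; have := w_edge 2%N k.+1 isT; have := w_edge 3%N k.+1 isT.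
  have := w_edge 2%N k.+2 isT; have := w_edge 1%N k.+3 isT.
  rewrite !(add1n, add2n, addSn, add0n).
  case: (w k) => // b1; case: (w k.+1) => // b2; case: (w k.+2) => // a3.
  case: (w k.+3) => // b4; case: (w k.+4) => // a5 * _.
  by apply: (@no_BBABA b1 b2 a3 b4 a5) => //; split.
have [k0 sk0] : exists k, s k.
  by case s0: (s 0%N); [exists 0%N|exists 1%N; rewrite alt s0].
pose labelled k (x : 'I_d) :=
  if w k is inr b then if w k.+1 is inl a then a = b + D x else False else False.
(* With [w] reading [b a b' a'] from [k], the third-power edge from [b] to [a'] has a label strictly
   between those of [b a] and [b' a']. *)
have label_incr k x : s k -> labelled k x ->
  exists2 y : 'I_d, (x < y)%N & labelled k.+2 y.
  have := alt k; have := alt k.+1; have := alt k.+2; rewrite /labelled /s.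
  have := w_edge 3%N k isT; have := w_edge 2%N k isT.
  have := w_edge 2%N k.+1 isT; have := w_edge 1%N k.+2 isT.
  rewrite !(add1n, add2n, addSn, add0n).
  case: (w k) => [//|b]; case: (w k.+1) => [a|//]; case: (w k.+2) => [//|b'].
  case: (w k.+3) => [a'|//] /edge_label[y eqy] aa' bb' /edge_label[z eqz] _ _ _ _ eqx.
  exists y => //.
  exact: ltn_trans (label_lt_l aa' eqx eqz) (label_lt_r bb' eqz eqy).
have label0 : exists x : 'I_d, labelled k0 x.
  move: sk0 (alt k0) (w_edge 1%N k0 isT); rewrite /labelled /s add1n.
  by case: (w k0) => // b; case: (w k0.+1) => // a _ _ /edge_label.
have [m] : exists m, (m > d)%N by exists d.+1.
apply/negP; rewrite -leqNgt.
suff [k [x [_ le_mx _]]] : exists k (x : 'I_d), [/\ s k, (m <= x)%N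
                                                       & labelled k x].
  by rewrite (leq_trans le_mx) // ltnW.
elim: m => [|m [k [x [sk le_mx]]]].
  by case: label0 => x Hx; exists k0, x.
move/(label_incr k x sk) => [y xy Hy]; exists k.+2, y; split=> //.
  by rewrite !alt negbK.
exact: leq_ltn_trans xy.
Qed.

(** A vertex has [(#|G| - 1) / 2] in- and out-neighbours in its own half, and across it has [d] one
    way and [#|G| - d >= d] the other way. *)
Lemma B4_tournament_semidegree : (d.*2 <= #|G|)%N ->
  (#|G| + d.*2 <= (min_semidegree e).*2.+1)%N.
Proof.
move=> le_dG.
have cardS := card_antisym_ext no2 increasing_diff_anti.
have cardD : #|[set g : G | g \in codom D]| = d.
  by rewrite cardsE card_codom ?card_ord //; apply: B4_family_inj.
have cardDC : #|[set g : G | g \notin codom D]| = (#|G| - d)%N.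
  rewrite cardsCs -[in RHS]cardD; congr (_ - #|pred_of_set _|)%N.
  by apply/setP => g; rewrite !inE negbK.
set m := #|[set g | antisym_ext increasing_diff g]| in cardS.
have subr_inj (c : G) : injective (fun x => c - x) by move=> x y /addrI /oppr_inj.
have addNr_inj (c : G) : injective (fun x => x - c) by apply: addIr.
have transl (Q : pred G) c : #|[set x | Q (c - x)]| = #|[set x | Q x]|.
  exact: (card_pred_inj Q (@subr_inj c)).
have transr (Q : pred G) c : #|[set x | Q (x - c)]| = #|[set x | Q x]|.
  exact: (card_pred_inj Q (@addNr_inj c)).
have notinl c : #|[set x | c - x \notin codom D]| = (#|G| - d)%N.
  by rewrite -cardDC; apply: (transl [pred g | g \notin codom D]).
have notinr c : #|[set x | x - c \notin codom D]| = (#|G| - d)%N.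
  by rewrite -cardDC; apply: (transr [pred g | g \notin codom D]).
have meml c : #|[set x | c - x \in codom D]| = d.
  by rewrite -[RHS]cardD; apply: (transl [pred g | g \in codom D]).
have memr c : #|[set x | x - c \in codom D]| = d.
  by rewrite -[RHS]cardD; apply: (transr [pred g | g \in codom D]).
(* This covers the default value [#|V|] of the iterated minimum. *)
have le_mdG : (m + d <= #|G|)%N by lia.
have le_d : (d <= #|G| - d)%N by lia.
suff : (m + d <= min_semidegree e)%N by lia.
rewrite /min_semidegree; elim/big_ind: _ => [|x y ? ?|[a|b] _].
- by rewrite card_sum (leq_trans le_mdG) ?leq_addr.
- by rewrite leq_min; apply/andP.
- rewrite leq_min /outdegree /indegree !card_sum_set /=; apply/andP; split.
    by apply: leq_add; rewrite ?notinl //; apply: eq_leq; apply: esym (transl S a).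
  by apply: leq_add; rewrite ?meml //; apply: eq_leq; apply: esym (transr S a).
rewrite leq_min /outdegree /indegree !card_sum_set /= addnC; apply/andP; split.
  by apply: leq_add; rewrite ?memr //; apply: eq_leq; apply: esym (transr S b).
by apply: leq_add; rewrite ?notinr //; apply: eq_leq; apply: esym (transl S b).
Qed.

End Tournament.

(** * Instantiation over ['F_p] and asymptotics *)

Lemma Fp_natr_neq0 p m : prime p -> ~~ (p %| m) -> (m%:R : 'F_p)%R != 0%R.
Proof. by move=> p_pr; rewrite -(dvdn_pcharf (pchar_Fp p_pr)). Qed.

(** Since [p > 3], both 2 and 24 are invertible in ['F_p]. The field is itself an ordinal type, so
    its elements serve directly as the [p] ordered labels. *)
Lemma tournament_no_cube p : prime p -> 3 < p ->
  exists e : rel ('rV['F_p]_4 + 'rV['F_p]_4), [/\ is_tournament e,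
    p ^ 4 + p.*2 <= (min_semidegree e).*2.+1 & ~ has_hamilton_cycle_cube e].
Proof.
move=> p_pr p_gt3.
have cop k : 1 < k -> k < 4 -> ~~ (p %| k).
  by move=> k1 k4; apply: contraL p_gt3 => /dvdn_leq; lia.
have no2 (g : 'rV['F_p]_4) : (g + g = 0 -> g = 0)%R.
  move=> /rowP g2; apply/rowP => i; have /eqP := g2 i.
  rewrite !mxE -mulr2n -mulr_natr mulf_eq0.
  by rewrite (negbTE (Fp_natr_neq0 p_pr (cop 2 _ _))) // orbF => /eqP.
have B4 : B4_family (@moment_curve 'F_p).
  apply: moment_curve_B4; apply: Fp_natr_neq0 => //.
  rewrite (_ : 24 = 2 ^ 3 * 3) // Euclid_dvdM // Euclid_dvdX //.
  by rewrite (negbTE (cop 2 _ _)) // (negbTE (cop 3 _ _)).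
have cardF : (Zp_trunc (pdiv p)).+2 = p by rewrite -[RHS](card_Fp p_pr) card_ord.
have cardG : #|'rV['F_p]_4| = p ^ 4 by rewrite card_mx mul1n card_Fp.
exists (B4_tournament (@moment_curve 'F_p)); split.
- exact: B4_tournamentP.
- rewrite -cardG -[X in X.*2]cardF; apply: B4_tournament_semidegree => //.
  rewrite cardG cardF -mul2n expnSr leq_mul2r (leq_trans _ (_ : p <= p ^ 3)) ?orbT //.
    by lia.
  by rewrite -[X in X <= _](expn1 p) leq_exp2l //; lia.
by apply: B4_tournament_no_cube => //; rewrite cardG expn_gt0 prime_gt0.
Qed.

Local Open Scope classical_set_scope.
Local Open Scope ring_scope.

Lemma unbounded_infinite_set (A : set nat) :
  (forall m, exists2 n, (m < n)%N & A n) -> infinite_set A.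
Proof.
move=> unb /finite_fsetP[X AX].
have [n lt_n] := unb (\max_(x <- finmap.enum_fset X) x)%N.
by rewrite AX /= => nX; move: lt_n; rewrite ltnNge leq_bigmax_seq.
Qed.

Lemma powR_inv_le (R : realType) (x y : R) k : (0 < k)%N -> 0 <= x -> 0 <= y ->
  x <= y ^+ k -> x `^ (1 / k%:R) <= y.
Proof.
move=> k_gt0 x0 y0 le_xy.
have k0 : 0 <= 1 / k%:R :> R by rewrite divr_ge0.
rewrite (le_trans (ge0_ler_powR k0 _ _ le_xy)) ?nnegrE ?exprn_ge0 //.
by rewrite -powR_mulrn // -powRrM mul1r mulfV ?pnatr_eq0 -?lt0n // powRr1.
Qed.

Theorem theorem1p4 (R : realType) :
  exists2 c : R, 0 < c &
    infinite_set [set n : nat |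
      exists V : finType, exists e : rel V,
        [/\ #|V| = n,
            is_tournament e,
            n%:R / 4 + c * n%:R `^ (1 / 5) <= (min_semidegree e)%:R :> R &
            ~ has_hamilton_cycle_cube e]].
Proof.
(* For [n = 2 p^4] the semidegree is at least [n/4 + p - 1/2]. As [n <= (2 p)^5], the required
   surplus is at most [(1/4) (2 p) = p/2], which is at most [p - 1/2]. *)
exists (1 / 4); first by rewrite divr_gt0.
apply: unbounded_infinite_set => m.
have [p lt_mp p_pr] := prime_above (maxn m 3).
have [lt_m p_gt3] : (m < p)%N /\ (3 < p)%N.
  by move: lt_mp; rewrite gtn_max => /andP.
have [e [e_tour e_deg e_cube]] := tournament_no_cube p_pr p_gt3.
exists (p ^ 4 + p ^ 4)%N.
  rewrite (leq_trans lt_m) // (leq_trans _ (leq_addr _ _)) // -[leqLHS]expn1.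
  by rewrite leq_exp2l // (leq_trans _ p_gt3).
exists ('rV['F_p]_4 + 'rV['F_p]_4)%type, e; split=> //.
  by rewrite card_sum !card_mx mul1n card_Fp.
have le_root : (p ^ 4 + p ^ 4)%:R `^ (1 / 5) <= 2 * p%:R :> R.
  apply: (@powR_inv_le _ _ _ 5) => //.
  rewrite -natrM -natrX ler_nat expnMn addnn -mul2n leq_mul // leq_exp2l //.
  by rewrite (leq_trans _ p_gt3).
have p_ge1 : 1 <= p%:R :> R by rewrite ler1n prime_gt0.
move: (min_semidegree e) e_deg le_root => k.
rewrite -(ler_nat R) -[k.*2.+1]addn1 -!addnn !natrD; lra.
Qed.
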